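(* Let $Q$ be a unital associative $\mathbb C$-algebra and let $T^+(u)=\sum_{k=0}^\infty T^+_ku^{-k}$ and $T^-(u)=\sum_{k=1}^\infty T^-_ku^{k}$, where $T^\pm_k$ are matrices with entries in $Q$, be a realization of the quantum loop algebra, i.e. $$R(u,v)\overset{1}{T}{}^+(u)\overset{2}{T}{}^+(v)=\overset{2}{T}{}^+(v)\overset{1}{T}{}^+(u)R(u,v),$$ $$R(u,v)\overset{1}{T}{}^+(u)\overset{2}{T}{}^-(v)=\overset{2}{T}{}^-(v)\overset{1}{T}{}^+(u)R(u,v),$$ $$R(u,v)\overset{1}{T}{}^-(u)\overset{2}{T}{}^-(v)=\overset{2}{T}{}^-(v)\overset{1}{T}{}^-(u)R(u,v),$$ with $R(u,v)=uR^{-\mathrm T}-vR$. Then the combination $$\mathbb A(u):=\bigl[T^-(u^{-1})\bigr]^{\mathrm T}T^+(u)=\sum_{k=0}^\infty A^{(k)}u^{-k-1}$$ satisfies the quantum affine reflection equation $$R(u,v)\,\overset{1}{\mathbb A}(u)\,R^{t_1}(u^{-1},v)\,\overset{2}{\mathbb A}(v)=\overset{2}{\mathbb A}(v)\,R^{t_1}(u^{-1},v)\,\overset{1}{\mathbb A}(u)\,R(u,v).$$ Moreover, the zero-level term $A^{(0)}=[T^-_1]^{\mathrm T}T^+_0$ satisfies the quantum reflection equation $$R\,\overset{1}{A}{}^{(0)}R^{t_1}\overset{2}{A}{}^{(0)}=\overset{2}{A}{}^{(0)}R^{t_1}\overset{1}{A}{}^{(0)}R.$$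
   Context: Let $q\in\mathbb C^*$. For each size $k$, $$R=R_k=\sum_{1\le i,j\le k}e_{ii}\otimes e_{jj}+(q-1)\sum_{1\le i\le k}e_{ii}\otimes e_{ii}+(q-q^{-1})\sum_{1\le j<i\le k}e_{ij}\otimes e_{ji},$$ acting on $V_k\otimes V_k$, $V_k=\mathbb C^k$. $R^{\mathrm T}$ is the total transpose, $R^{-\mathrm T}=(R^{-1})^{\mathrm T}$, and $t_1$ denotes partial transposition with respect to the first tensor factor; $R^{t_1}(u^{-1},v)=u^{-1}(R^{-\mathrm T})^{t_1}-vR^{t_1}$. The matrices $T^\pm_k$ are all of one common size $n_2\times n_1$ (in particular possibly square); $\mathbb A(u)$ is then $n_1\times n_1$. A number over a matrix indicates the tensor factor in which it acts (e.g. $\overset{1}{M}=\sum e_{ij}\otimes I\otimes M_{ij}$). Entries in $Q$ are always multiplied in the order in which the matrices are written. The matrix transposition $[\,\cdot\,]^{\mathrm T}$ acts only on matrix indices and does not affect the order of products in $Q$. The entries of $R$ are scalars and its size is determined by the position: in the loop algebra relations it acts on $V_{n_2}\otimes V_{n_2}$ on the left and on $V_{n_1}\otimes V_{n_1}$ on the right; in the reflection equations it acts on $V_{n_1}\otimes V_{n_1}$. Relations containing $u,v$ are identities of formal series (coefficientwise). *)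

(* Defs.v *)
From mathcomp Require Import all_boot all_order all_algebra.
From mathcomp Require Import complex mxtens.
From mathcomp Require Import boolp classical_sets fsbigop reals.

Set Implicit Arguments.
Unset Strict Implicit.
Unset Printing Implicit Defensive.

Import Order.TTheory GRing.Theory Num.Theory.

Local Open Scope classical_set_scope.
Local Open Scope ring_scope.

(* A bilateral formal series with m x n matrix coefficients is the function   *)
(* sending an exponent to its coefficient: [E = int] in one variable, and     *)
(* [E = int * int] in two, where (a, b) stands for the monomial u^a v^b.      *)
Definition fser (E : Type) (Q : Type) (m n : nat) := E -> 'M[Q]_(m, n).

(* Cauchy product. The \sum_(_ \in _) operator is 0 on an infinite support;   *)
(* the products formed below (Laurent polynomials with series in separate     *)
(* variables, or two series bounded above in the same variable) have only     *)
(* finitely many nonzero terms in every coefficient.                          *)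
Definition fmul (E : zmodType) (Q : pzRingType) (m n p : nat)
    (F : fser E Q m n) (G : fser E Q n p) : fser E Q m p :=
  fun e => \sum_(d \in [set: E]) (F d *m G (e - d)).

Notation "F *f G" := (fmul F G) (at level 40, left associativity).

Definition fmono (E : eqType) (Q : nmodType) (m n : nat)
    (e : E) (M : 'M[Q]_(m, n)) : fser E Q m n :=
  fun d => if d == e then M else 0.

Definition fser_sub (E : Type) (Q : zmodType) (m n : nat)
    (F G : fser E Q m n) : fser E Q m n := fun e => F e - G e.

Definition fser_inv (Q : Type) (m n : nat) (F : fser int Q m n) :
    fser int Q m n := fun a => F (- a).

Definition fser_tr (Q : Type) (m n : nat) (F : fser int Q m n) :
    fser int Q n m := fun a => (F a)^T.

(* [overset 1 M] and [overset 2 M] on a two-fold tensor product, the other    *)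
(* factor having dimension p.                                                 *)
Definition op1 (Q : pzRingType) (p m n : nat) (M : 'M[Q]_(m, n)) :
    'M[Q]_(m * p, n * p) := tensmx M 1%:M.

Definition op2 (Q : pzRingType) (p m n : nat) (M : 'M[Q]_(m, n)) :
    'M[Q]_(p * m, p * n) := tensmx 1%:M M.

(* F(u) acting in the first factor and F(v) acting in the second.             *)
Definition fop1 (Q : pzRingType) (p m n : nat) (F : fser int Q m n) :
    fser (int * int) Q (m * p) (n * p) :=
  fun e => if e.2 == 0 then op1 p (F e.1) else 0.

Definition fop2 (Q : pzRingType) (p m n : nat) (F : fser int Q m n) :
    fser (int * int) Q (p * m) (p * n) :=
  fun e => if e.1 == 0 then op2 p (F e.2) else 0.

Arguments op1 {Q} p {m n} M.
Arguments op2 {Q} p {m n} M.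
Arguments fop1 {Q} p {m n} F.
Arguments fop2 {Q} p {m n} F.

(* (e_ij (x) N)^{t1} = e_ji (x) N.                                            *)
Definition ptr1 (K : Type) (k : nat) (M : 'M[K]_(k * k)) : 'M[K]_(k * k) :=
  \matrix_(x, y)
    M (mxtens_index ((mxtens_unindex y).1, (mxtens_unindex x).2))
      (mxtens_index ((mxtens_unindex x).1, (mxtens_unindex y).2)).

Section Rmatrix.
Variables (K : fieldType) (q : K) (k : nat).

Definition Rmx : 'M[K]_(k * k) :=
  \sum_(i < k) \sum_(j < k) tensmx (delta_mx i i) (delta_mx j j)
  + (q - 1) *: (\sum_(i < k) tensmx (delta_mx i i) (delta_mx i i))
  + (q - q^-1) *:
      (\sum_(i < k) \sum_(j < k | (j < i)%N)
         tensmx (delta_mx i j) (delta_mx j i)).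

(* R^{-T}; Rmx is invertible whenever q != 0 (triangular, determinant q^k),   *)
(* so invmx is the actual inverse.                                            *)
Definition RmxNT : 'M[K]_(k * k) := (invmx Rmx)^T.

Variable Q : algType K.

Definition scal_mx (m n : nat) (M : 'M[K]_(m, n)) : 'M[Q]_(m, n) :=
  map_mx (fun c : K => c%:A) M.

(* R(u, v) = u R^{-T} - v R.                                                  *)
Definition Ruv : fser (int * int) Q (k * k) (k * k) :=
  fser_sub (fmono (1, 0) (scal_mx RmxNT)) (fmono (0, 1) (scal_mx Rmx)).

(* R^{t1}(u^{-1}, v) = u^{-1} (R^{-T})^{t1} - v R^{t1}.                       *)
Definition Rt1uv : fser (int * int) Q (k * k) (k * k) :=
  fser_sub (fmono (- 1, 0) (scal_mx (ptr1 RmxNT)))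
       (fmono (0, 1) (scal_mx (ptr1 Rmx))).

End Rmatrix.

Arguments Rmx {K} q k.
Arguments RmxNT {K} q k.
Arguments scal_mx {K} Q {m n} M.
Arguments Ruv {K} q k Q.
Arguments Rt1uv {K} q k Q.

Section Loop.
Variables (K : fieldType) (q : K) (Q : algType K).

(* R(u,v) X1(u) Y2(v) = Y2(v) X1(u) R(u,v), with R(u,v) acting on             *)
(* V_{n2} (x) V_{n2} on the left and on V_{n1} (x) V_{n1} on the right.       *)
Definition RTT_rel (n2 n1 : nat) (X Y : fser int Q n2 n1) : Prop :=
  Ruv q n2 Q *f fop1 n2 X *f fop2 n1 Y
    =1 fop2 n2 Y *f fop1 n1 X *f Ruv q n1 Q.

(* T^+(u) = \sum_(k >= 0) T^+_k u^(-k).                                       *)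
Definition Tplus (n2 n1 : nat) (Tp : nat -> 'M[Q]_(n2, n1)) :
    fser int Q n2 n1 :=
  fun a => if a <= 0 then Tp `|a|%N else 0.

(* T^-(u) = \sum_(k >= 1) T^-_k u^k; the value [Tm 0] is not used.            *)
Definition Tminus (n2 n1 : nat) (Tm : nat -> 'M[Q]_(n2, n1)) :
    fser int Q n2 n1 :=
  fun a => if 0 < a then Tm `|a|%N else 0.

Definition loop_realization (n2 n1 : nat) (Tp Tm : nat -> 'M[Q]_(n2, n1)) :
    Prop :=
  [/\ RTT_rel (Tplus Tp) (Tplus Tp),
      RTT_rel (Tplus Tp) (Tminus Tm)
    & RTT_rel (Tminus Tm) (Tminus Tm)].

(* [T^-(u^{-1})]^T T^+(u).                                                    *)
Definition AA (n2 n1 : nat) (Tp Tm : nat -> 'M[Q]_(n2, n1)) :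
    fser int Q n1 n1 :=
  fser_tr (fser_inv (Tminus Tm)) *f Tplus Tp.

(* \sum_(k >= 0) A_k u^(-k-1).                                                *)
Definition Aser (n : nat) (A : nat -> 'M[Q]_n) : fser int Q n n :=
  fun a => if a < 0 then A (`|a|%N.-1) else 0.

Definition affine_reflection (n : nat) (A : fser int Q n n) : Prop :=
  Ruv q n Q *f fop1 n A *f Rt1uv q n Q *f fop2 n A
    =1 fop2 n A *f Rt1uv q n Q *f fop1 n A *f Ruv q n Q.

Definition reflection (n : nat) (A : 'M[Q]_n) : Prop :=
  let R := scal_mx Q (Rmx q n) in
  let Rt1 := scal_mx Q (ptr1 (Rmx q n)) in
  R *m op1 n A *m Rt1 *m op2 n A = op2 n A *m Rt1 *m op1 n A *m R.

End Loop.

(* Main.v *)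
(* Write R^{t1}(u^{-1},v) as R', and S(u) = T^-(u^{-1})^T. With A = S T, the    *)
(* reflection equation follows by moving factors past each other in            *)
(* R S1 T1 R' S2 T2, using T1 R' S2 = S2 R' T1, T2 R' S1 = S1 R' T2,           *)
(* R S1 S2 = S2 S1 R, R T1 T2 = T2 T1 R, and the fact that R(u,v) commutes     *)
(* with R'. The relations involving S are (partial) transposes of the loop     *)
(* algebra relations after R(u,v) has been replaced by its inverse, which is   *)
(* v R^{-1} - u R^T up to a scalar factor quadratic in u and v. For bilateral  *)
(* series dividing by that factor is legitimate only because T^+ and T^- are   *)
(* bounded on one side. The zero-level equation is the coefficient of u^-1 v.  *)

From HB Require Import structures.
Require Import Defs.
From mathcomp Require Import all_boot all_order all_algebra.
From mathcomp Require Import complex mxtens.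
From mathcomp Require Import boolp classical_sets fsbigop reals.
From mathcomp Require Import zify ring.

Set Implicit Arguments.
Unset Strict Implicit.
Unset Printing Implicit Defensive.

Import Order.TTheory GRing.Theory Num.Theory.
Local Open Scope ring_scope.

(** The proof rests on two facts about the constant matrix [R = dgmx q + h *: flipmx], with
    [h = q - q^-1]. The first is that R^{-1} R^{-T} + R^T R, and likewise R^{-T} R^{-1} + R R^T, is
    the scalar c = q^2 + q^{-2} ([hecke_left], [hecke_right]), so v R^{-1} - u R^T inverts R(u,v) up
    to the factor c uv - u^2 - v^2. The second is that R and R^{-T} commute with R^{t1} and
    (R^{-T})^{t1}, so R(u,v) commutes with R' ([Ruv_Rt1uvC]).

    By the first fact, [RTT_reverse] turns R(u,v) X1 Y2 = Y2 X1 R(u,v) into X1 Y2 (v R^{-1} - u R^T)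
    = (v R^{-1} - u R^T) Y2 X1. Now the scalar matrix stands next to Y2, so transposing the second
    tensor factor leaves the order of products in [Q] unchanged. With v replaced by v^{-1} this
    gives [exchange12]; exchanging the tensor factors gives [exchange21], and total transposition
    gives [RTT_tr_inv]. The chain of moves is [affine_reflection_tr_inv_mul].

    T^-(u) is unbounded above, so relations containing it are handled coefficient by coefficient.
    T^+(u) and T^-(u^{-1}) are bounded above, and for such series [fmulA] provides associativity. *)

Local Notation ix i j := (mxtens_index (i, j)).

(** * The R-matrix *)

Lemma tens_matrixP (Q : Type) (m n p r : nat) (A B : 'M[Q]_(m * n, p * r)) :
  (forall i j k l, A (ix i j) (ix k l) = B (ix i j) (ix k l)) -> A = B.
Proof.
move=> AB; apply/matrixP => x y.
by case: (mxtens_indexP x) => i j; case: (mxtens_indexP y) => k l.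
Qed.

Lemma sum_tens (V : nmodType) (m n : nat) (F : 'I_(m * n) -> V) :
  \sum_x F x = \sum_i \sum_j F (ix i j).
Proof.
rewrite pair_bigA /= (reindex (@mxtens_index m n)) /=; last first.
  by exists (@mxtens_unindex m n) => x _; rewrite (mxtens_indexK, mxtens_unindexK).
by apply: eq_bigr => -[].
Qed.

Section TensorIndices.
Variable Q : Type.

Definition ptr2 (m n p r : nat) (M : 'M[Q]_(m * n, p * r)) :
    'M[Q]_(m * r, p * n) :=
  \matrix_(x, y)
    M (ix (mxtens_unindex x).1 (mxtens_unindex y).2)
      (ix (mxtens_unindex y).1 (mxtens_unindex x).2).

Definition mxswap (m n p r : nat) (M : 'M[Q]_(m * n, p * r)) :
    'M[Q]_(n * m, r * p) :=
  \matrix_(x, y)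
    M (ix (mxtens_unindex x).2 (mxtens_unindex x).1)
      (ix (mxtens_unindex y).2 (mxtens_unindex y).1).

Lemma ptr1E (k : nat) (M : 'M[Q]_(k * k)) i j l m :
  ptr1 M (ix i j) (ix l m) = M (ix l j) (ix i m).
Proof. by rewrite mxE !mxtens_indexK. Qed.

Lemma ptr2E (m n p r : nat) (M : 'M[Q]_(m * n, p * r)) i j l k :
  ptr2 M (ix i j) (ix l k) = M (ix i k) (ix l j).
Proof. by rewrite mxE !mxtens_indexK. Qed.

Lemma mxswapE (m n p r : nat) (M : 'M[Q]_(m * n, p * r)) i j l k :
  mxswap M (ix i j) (ix l k) = M (ix j i) (ix k l).
Proof. by rewrite mxE !mxtens_indexK. Qed.

Lemma ptr2_tr (k : nat) (M : 'M[Q]_(k * k)) : ptr2 M^T = ptr1 M.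
Proof. by apply/tens_matrixP => i j l m; rewrite ptr2E ptr1E mxE. Qed.

Lemma mxswap_tr (m n p r : nat) (M : 'M[Q]_(m * n, p * r)) :
  mxswap M^T = (mxswap M)^T.
Proof. by apply/tens_matrixP => i j l k; rewrite mxswapE mxE [RHS]mxE mxswapE. Qed.

Lemma mxswap_ptr1 (k : nat) (M : 'M[Q]_(k * k)) :
  mxswap (ptr1 M) = ptr1 (mxswap M)^T.
Proof.
by apply/tens_matrixP => i j l m; rewrite -mxswap_tr mxswapE !ptr1E mxswapE mxE.
Qed.

End TensorIndices.

(** * Diagonal and flip parts of [R]: inverse, quadratic and commutation identities *)

Section HeckeR.
Variables (K : fieldType) (k : nat).

(** Acts by c on the vectors e_i ⊗ e_i and trivially on e_i ⊗ e_j with i distinct from j. *)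
Definition dgmx (c : K) : 'M[K]_(k * k) :=
  diag_mx (\row_x (if (mxtens_unindex x).1 == (mxtens_unindex x).2
                   then c else 1)).

Definition flipmx : 'M[K]_(k * k) :=
  \matrix_(x, y)
    let: (i, j) := mxtens_unindex x in
    let: (l, m) := mxtens_unindex y in
    [&& i == m, j == l & (j < i)%N]%:R.

Lemma mul_dgmxE c (n : nat) (M : 'M_(k * k, n)) i j y :
  (dgmx c *m M) (ix i j) y = (if i == j then c else 1) * M (ix i j) y.
Proof. by rewrite mul_diag_mx !mxE mxtens_indexK. Qed.

Lemma mulmx_dgE c (n : nat) (M : 'M_(n, k * k)) x i j :
  (M *m dgmx c) x (ix i j) = M x (ix i j) * (if i == j then c else 1).
Proof. by rewrite mul_mx_diag !mxE mxtens_indexK. Qed.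

Lemma flipmxE i j l m :
  flipmx (ix i j) (ix l m) = [&& i == m, j == l & (j < i)%N]%:R.
Proof. by rewrite mxE !mxtens_indexK. Qed.

Lemma eq_ix (m n : nat) (i l : 'I_m) (j p : 'I_n) :
  (ix i j == ix l p) = (i == l) && (j == p).
Proof. by rewrite (can_eq (@mxtens_indexK _ _)) xpair_eqE. Qed.

Lemma dgmxE c i j l m :
  dgmx c (ix i j) (ix l m) =
  (if i == j then c else 1) * ((i == l) && (j == m))%:R.
Proof. by rewrite !mxE mxtens_indexK eq_ix mulr_natr. Qed.

Lemma dgmx1 : dgmx 1 = 1%:M.
Proof.
by apply/tens_matrixP => i j l m; rewrite dgmxE mxE eq_ix if_same mul1r.
Qed.

Lemma tr_dgmx c : (dgmx c)^T = dgmx c.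
Proof. exact: tr_diag_mx. Qed.

Lemma dgmxM b c : dgmx b *m dgmx c = dgmx (b * c).
Proof.
apply/tens_matrixP => i j l m; rewrite mul_dgmxE !dgmxE mulrA.
by case: ifP => //; rewrite mul1r.
Qed.

Lemma dgmx_flip c : dgmx c *m flipmx = flipmx.
Proof.
apply/tens_matrixP => i j l m; rewrite mul_dgmxE flipmxE.
by case: eqP => [->|]; rewrite ?mul1r// ltnn !andbF mulr0.
Qed.

Lemma flip_dgmx c : flipmx *m dgmx c = flipmx.
Proof.
apply/tens_matrixP => i j l m; rewrite mulmx_dgE flipmxE.
case: (l =P m) => [->|]; rewrite ?mulr1//.
suff -> : [&& i == m, j == m & (j < i)%N] = false by rewrite mul0r.
by apply/and3P => -[/eqP-> /eqP->]; rewrite ltnn.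
Qed.

(** The partial transpose of [flipmx] is the sum of e_ji ⊗ e_ji over j < i, which lives entirely on
    the span of the e_i ⊗ e_i. There [dgmx c] is multiplication by c, whereas [flipmx] vanishes;
    taking c = 0 therefore kills all mixed products below. *)
Lemma dgmx_ptr1_flip c : dgmx c *m ptr1 flipmx = c *: ptr1 flipmx.
Proof.
apply/tens_matrixP => i j l m; rewrite mul_dgmxE [RHS]mxE ptr1E flipmxE.
by rewrite [j == i]eq_sym; case: eqP => //=; rewrite andbF !mulr0.
Qed.

Lemma ptr1_flip_dgmx c : ptr1 flipmx *m dgmx c = c *: ptr1 flipmx.
Proof.
apply/tens_matrixP => i j l m; rewrite mulmx_dgE [RHS]mxE ptr1E flipmxE.
by rewrite [RHS]mulrC; case: (l =P m) => //= _; rewrite ?mul0r.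
Qed.

Lemma mul_flipE (n : nat) (N : 'M_(k * k, n)) i j y :
  (flipmx *m N) (ix i j) y = (j < i)%N%:R * N (ix j i) y.
Proof.
rewrite mxE (bigD1 (ix j i)) //= flipmxE !eqxx big1 ?addr0 // => x.
case: (mxtens_indexP x) => l m; rewrite eq_ix flipmxE [i == m]eq_sym [j == l]eq_sym.
by move=> /negPf ne; rewrite andbA [(m == i) && _]andbC ne mul0r.
Qed.

Lemma mul_tr_flipE (n : nat) (N : 'M_(k * k, n)) i j y :
  (flipmx^T *m N) (ix i j) y = (i < j)%N%:R * N (ix j i) y.
Proof.
rewrite mxE (bigD1 (ix j i)) //= mxE flipmxE !eqxx big1 ?addr0 // => x.
case: (mxtens_indexP x) => l m; rewrite eq_ix mxE flipmxE.
by move=> /negPf ne; rewrite andbA ne mul0r.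
Qed.

(** [flipmx] sends e_j ⊗ e_i with j < i to e_i ⊗ e_j and kills the other basis vectors, including
    its own image. *)
Lemma flip_flip : flipmx *m flipmx = 0.
Proof.
apply/tens_matrixP => i j l m; rewrite mul_flipE flipmxE mxE -natrM mulnb.
by case: ltnP => //= /ltnW; rewrite leqNgt => /negPf ->; rewrite !andbF.
Qed.

(** The two summands are the projections onto the e_i ⊗ e_j with i > j and with i < j. *)
Lemma flip_tr_flip : flipmx *m flipmx^T + flipmx^T *m flipmx = dgmx 0.
Proof.
apply/tens_matrixP => i j l m.
rewrite mxE mul_flipE mul_tr_flipE [flipmx^T _ _]mxE !flipmxE dgmxE.
rewrite [m == j]eq_sym [l == i]eq_sym.
case: (i =P l) => [<-|_]; rewrite ?andbF ?mulr0 ?addr0 //=.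
case: (j =P m) => [<-|_]; rewrite ?andbF ?mulr0 ?addr0 //= ?mulr1.
by rewrite -!natrM !mulnb !andbb -val_eqE /=; case: ltngtP; rewrite ?addr0 ?add0r.
Qed.

Lemma mxswap_flip : mxswap flipmx = flipmx^T.
Proof.
apply/tens_matrixP => i j l m; rewrite mxswapE [RHS]mxE !flipmxE.
by rewrite [j == l]eq_sym [i == m]eq_sym; case: eqP => //= ->; case: eqP => // ->.
Qed.

Lemma mxswap_dgmx c : mxswap (dgmx c) = dgmx c.
Proof.
by apply/tens_matrixP => i j l m; rewrite mxswapE !dgmxE [j == i]eq_sym andbC.
Qed.

Lemma ptr1_dgmx c : ptr1 (dgmx c) = dgmx c.
Proof.
apply/tens_matrixP => i j l m; rewrite ptr1E !dgmxE [l == i]eq_sym.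
by case: (i =P l) => [->|_] //=; rewrite !mulr0.
Qed.

Lemma ptr1D (M N : 'M[K]_(k * k)) : ptr1 (M + N) = ptr1 M + ptr1 N.
Proof. by apply/matrixP => x y; rewrite !mxE. Qed.

Lemma ptr1Z c (M : 'M[K]_(k * k)) : ptr1 (c *: M) = c *: ptr1 M.
Proof. by apply/matrixP => x y; rewrite !mxE. Qed.

Lemma ptr1_tr (M : 'M[K]_(k * k)) : ptr1 M^T = (ptr1 M)^T.
Proof. by apply/tens_matrixP => i j l m; rewrite ptr1E mxE [RHS]mxE ptr1E. Qed.

Lemma mxswapD (M N : 'M[K]_(k * k)) : mxswap (M + N) = mxswap M + mxswap N.
Proof. by apply/matrixP => x y; rewrite !mxE. Qed.

Lemma mxswapZ c (M : 'M[K]_(k * k)) : mxswap (c *: M) = c *: mxswap M.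
Proof. by apply/matrixP => x y; rewrite !mxE. Qed.

Lemma flip_ptr1_flip : flipmx *m ptr1 flipmx = 0.
Proof. by rewrite -{1}(flip_dgmx 0) -mulmxA dgmx_ptr1_flip scale0r mulmx0. Qed.

Lemma ptr1_flip_flip : ptr1 flipmx *m flipmx = 0.
Proof. by rewrite -{2}(dgmx_flip 0) mulmxA ptr1_flip_dgmx scale0r mul0mx. Qed.

Lemma tr_flip_ptr1_flip : flipmx^T *m ptr1 flipmx = 0.
Proof.
rewrite -{1}(dgmx_flip 0) trmx_mul tr_dgmx -mulmxA dgmx_ptr1_flip scale0r.
by rewrite mulmx0.
Qed.

Lemma ptr1_flip_tr_flip : ptr1 flipmx *m flipmx^T = 0.
Proof.
rewrite -{2}(flip_dgmx 0) trmx_mul tr_dgmx mulmxA ptr1_flip_dgmx scale0r.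
by rewrite mul0mx.
Qed.

(** Diagonal parts commute, [dgmx] fixes [flipmx] on both sides and scales its partial transpose on
    both sides, and the products of [flipmx] with that partial transpose vanish. *)
Lemma dg_flip_comm_ptr1 (a b : K) (al be : K) :
  comm_mx (dgmx a + al *: flipmx) (ptr1 (dgmx b + be *: flipmx)).
Proof.
rewrite /comm_mx ptr1D ptr1Z ptr1_dgmx !mulmxDl !mulmxDr.
rewrite -!scalemxAl -!scalemxAr !dgmxM dgmx_flip flip_dgmx dgmx_ptr1_flip.
by rewrite ptr1_flip_dgmx flip_ptr1_flip ptr1_flip_flip mulrC !scaler0 !addr0 addrAC.
Qed.

Lemma tr_dg_flip a al :
  (dgmx a + al *: flipmx)^T = dgmx a + al *: flipmx^T.
Proof. by rewrite linearD linearZ /= tr_dgmx. Qed.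

Lemma dgmx_tr_flip c : dgmx c *m flipmx^T = flipmx^T.
Proof. by rewrite -{1}(tr_dgmx c) -trmx_mul flip_dgmx. Qed.

Lemma tr_flip_dgmx c : flipmx^T *m dgmx c = flipmx^T.
Proof. by rewrite -{1}(tr_dgmx c) -trmx_mul dgmx_flip. Qed.

Lemma dg_tr_flip_comm_ptr1 (a b : K) (al be : K) :
  comm_mx (dgmx a + al *: flipmx)^T (ptr1 (dgmx b + be *: flipmx)).
Proof.
rewrite /comm_mx ptr1D ptr1Z ptr1_dgmx tr_dg_flip.
rewrite !mulmxDl !mulmxDr -!scalemxAl -!scalemxAr !dgmxM.
rewrite dgmx_tr_flip tr_flip_dgmx dgmx_ptr1_flip ptr1_flip_dgmx tr_flip_ptr1_flip ptr1_flip_tr_flip.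
by rewrite mulrC !scaler0 !addr0 addrAC.
Qed.

Variable q : K.
Hypothesis q_neq0 : q != 0.
Let h := q - q^-1.

Lemma sum_delta (i l : 'I_k) (F : 'I_k -> K) :
  \sum_a (delta_mx a a : 'M[K]_k) i l * F a = (i == l)%:R * F i.
Proof.
rewrite (bigD1 i) //= big1 => [|a].
  by rewrite addr0 mxE eqxx [l == i]eq_sym.
by move=> ai; rewrite mxE [i == a]eq_sym (negPf ai) mul0r.
Qed.

(** The first double sum is the identity and the second sum is the projection onto the span of the
    e_i ⊗ e_i, so together they form [dgmx q]. *)
Lemma RmxE : Rmx q k = dgmx q + h *: flipmx.
Proof.
apply/tens_matrixP => i j l m.
rewrite mxE [RHS]mxE; congr (_ + _); last first.
  rewrite mxE [RHS]mxE flipmxE; congr (_ * _).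
  rewrite summxE (bigD1 i) //= [X in _ + X]big1 ?addr0; last first.
    move=> a; rewrite eq_sym => /negPf ia; rewrite summxE big1 // => b _.
    by rewrite tensmxE mxE ia mul0r.
  rewrite summxE; have [ji|ij] := ltnP j i; last first.
    rewrite !andbF big1 // => b bi; rewrite tensmxE [X in _ * X]mxE.
    case: (j =P b) => [jb|]; last by rewrite mulr0.
    by rewrite -jb ltnNge ij in bi.
  rewrite (bigD1 j) //= tensmxE !mxE !eqxx big1 ?addr0; last first.
    move=> b /andP[_]; rewrite eq_sym => /negPf jb.
    by rewrite tensmxE [X in _ * X]mxE jb mulr0.
  by rewrite -natrM mulnb andbC andbT [i == m]eq_sym [j == l]eq_sym.
rewrite mxE [X in _ + X]mxE !summxE dgmxE.
under eq_bigr do rewrite summxE.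
under eq_bigr do under eq_bigr do rewrite tensmxE.
under eq_bigr do rewrite -mulr_sumr.
rewrite sum_delta [X in _ + _ * X](eq_bigr _ (fun a _ => tensmxE _ _ _ _ _ _)).
rewrite sum_delta; under eq_bigr do rewrite -[delta_mx _ _ _ _]mulr1.
rewrite sum_delta mulr1 mxE [j == i]eq_sym.
case: (i =P l) => _; last by rewrite !mul0r !mulr0 addr0.
rewrite !mul1r; case: (i =P j) => [<-|_] /=; last by rewrite mulr0 addr0 mul1r.
rewrite [m == i]eq_sym; case: eqP => _; rewrite ?mulr1 ?mulr0 ?addr0 //.
by rewrite addrC subrK.
Qed.

Lemma mulRmx_inv : Rmx q k *m (dgmx q^-1 - h *: flipmx) = 1%:M.
Proof.
rewrite RmxE mulmxDl !mulmxBr -!scalemxAl -!scalemxAr dgmxM dgmx_flip flip_dgmx.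
by rewrite flip_flip !scaler0 subr0 subrK divff // dgmx1.
Qed.

Lemma Rmx_unit : Rmx q k \in unitmx.
Proof. by case: (mulmx1_unit mulRmx_inv). Qed.

Lemma invRmxE : invmx (Rmx q k) = dgmx q^-1 + (- h) *: flipmx.
Proof.
by rewrite -[RHS]mul1mx -(mulVmx Rmx_unit) -mulmxA scaleNr mulRmx_inv mulmx1.
Qed.

Definition hecke_const : K := q ^+ 2 + q ^- 2.

Lemma dgmx_hecke :
  dgmx (q * q) + dgmx (q^-1 * q^-1) + h ^+ 2 *: dgmx 0 = hecke_const%:M.
Proof.
apply/tens_matrixP => i j l m; rewrite !mxE mxtens_indexK /= eq_ix.
case: (_ && _); rewrite ?mulr1n ?mulr0n ?mulr0 ?addr0 //.
by case: ifP => _; rewrite /hecke_const /h; field.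
Qed.

(** The terms linear in h cancel, since [R] and its inverse carry h with opposite signs. What
    remains is q^2 + q^{-2} on the e_i ⊗ e_i and 2 + h^2, the same number, elsewhere. *)
Lemma hecke_left :
  invmx (Rmx q k) *m RmxNT q k + (Rmx q k)^T *m Rmx q k = hecke_const%:M.
Proof.
rewrite /RmxNT invRmxE RmxE !tr_dg_flip -dgmx_hecke -flip_tr_flip.
rewrite !mulmxDl !mulmxDr -!scalemxAl -!scalemxAr !dgmxM dgmx_flip flip_dgmx.
rewrite dgmx_tr_flip tr_flip_dgmx !scalerA mulrNN -expr2 !scaleNr scalerDr.
set A := dgmx _; set B := dgmx _; set C := h *: _; set D := h *: _.
set E := h ^+ 2 *: _; set F := h ^+ 2 *: _.
move: A B C D E F => A B C D E F.
by apply/matrixP => x y; rewrite !mxE; ring.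
Qed.

Lemma hecke_right :
  RmxNT q k *m invmx (Rmx q k) + Rmx q k *m (Rmx q k)^T = hecke_const%:M.
Proof.
rewrite /RmxNT invRmxE RmxE !tr_dg_flip -dgmx_hecke -flip_tr_flip.
rewrite !mulmxDl !mulmxDr -!scalemxAl -!scalemxAr !dgmxM dgmx_flip flip_dgmx.
rewrite dgmx_tr_flip tr_flip_dgmx !scalerA mulrNN -expr2 !scaleNr scalerDr.
set A := dgmx _; set B := dgmx _; set C := h *: _; set D := h *: _.
set E := h ^+ 2 *: _; set F := h ^+ 2 *: _.
move: A B C D E F => A B C D E F.
by apply/matrixP => x y; rewrite !mxE; ring.
Qed.

Lemma mxswap_Rmx : mxswap (Rmx q k) = (Rmx q k)^T.
Proof. by rewrite RmxE mxswapD mxswapZ mxswap_dgmx mxswap_flip tr_dg_flip. Qed.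

Lemma mxswap_RmxNT : mxswap (RmxNT q k) = (RmxNT q k)^T.
Proof.
rewrite /RmxNT mxswap_tr invRmxE.
by rewrite mxswapD mxswapZ mxswap_dgmx mxswap_flip tr_dg_flip.
Qed.

(** Exchanging the tensor factors turns [R] into its transpose and t1 into transposition of the
    second factor; the two effects cancel. *)
Lemma mxswap_ptr1_Rmx : mxswap (ptr1 (Rmx q k)) = ptr1 (Rmx q k).
Proof. by rewrite mxswap_ptr1 mxswap_Rmx trmxK. Qed.

Lemma mxswap_ptr1_RmxNT : mxswap (ptr1 (RmxNT q k)) = ptr1 (RmxNT q k).
Proof. by rewrite mxswap_ptr1 mxswap_RmxNT trmxK. Qed.

Lemma comm_Rmx_ptr1_Rmx : comm_mx (Rmx q k) (ptr1 (Rmx q k)).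
Proof. by rewrite RmxE; apply: dg_flip_comm_ptr1. Qed.

Lemma comm_RmxNT_ptr1_Rmx : comm_mx (RmxNT q k) (ptr1 (Rmx q k)).
Proof. by rewrite /RmxNT invRmxE RmxE; apply: dg_tr_flip_comm_ptr1. Qed.

Lemma comm_Rmx_ptr1_RmxNT : comm_mx (Rmx q k) (ptr1 (RmxNT q k)).
Proof.
rewrite /RmxNT ptr1_tr invRmxE RmxE /comm_mx.
apply: (can_inj (@trmxK _ _ _)); rewrite !trmx_mul trmxK.
by apply/esym/dg_tr_flip_comm_ptr1.
Qed.

Lemma comm_RmxNT_ptr1_RmxNT : comm_mx (RmxNT q k) (ptr1 (RmxNT q k)).
Proof.
rewrite /RmxNT ptr1_tr invRmxE /comm_mx.
apply: (can_inj (@trmxK _ _ _)); rewrite !trmx_mul !trmxK.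
by apply/esym/dg_flip_comm_ptr1.
Qed.
End HeckeR.

(** * Tensor operators and the reversed exchange relation *)

Section TensorOperators.
Variable Q : pzRingType.

Lemma mul_op1E (m n p r : nat) (X : 'M[Q]_(m, n)) (W : 'M[Q]_(n * p, r)) i j y :
  (op1 p X *m W) (ix i j) y = \sum_a X i a * W (ix a j) y.
Proof.
rewrite mxE sum_tens; apply: eq_bigr => a _.
rewrite (bigD1 j) //= tensmxE mxE eqxx mulr1 big1 ?addr0 // => b.
by rewrite eq_sym tensmxE mxE => /negPf ->; rewrite mulr0 mul0r.
Qed.

Lemma mul_op2E (m n p r : nat) (X : 'M[Q]_(m, n)) (W : 'M[Q]_(p * n, r)) i j y :
  (op2 p X *m W) (ix i j) y = \sum_b X j b * W (ix i b) y.
Proof.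
rewrite mxE sum_tens exchange_big; apply: eq_bigr => b _.
rewrite (bigD1 i) //= tensmxE mxE eqxx mul1r big1 ?addr0 // => a.
by rewrite eq_sym tensmxE mxE => /negPf ->; rewrite !mul0r.
Qed.

Lemma mulmx_op1E (m n p r : nat) (X : 'M[Q]_(m, n)) (W : 'M[Q]_(r, m * p)) x i j :
  (W *m op1 p X) x (ix i j) = \sum_a W x (ix a j) * X a i.
Proof.
rewrite mxE sum_tens; apply: eq_bigr => a _.
rewrite (bigD1 j) //= tensmxE mxE eqxx mulr1 big1 ?addr0 // => b.
by rewrite tensmxE mxE => /negPf ->; rewrite !mulr0.
Qed.

Lemma mulmx_op2E (m n p r : nat) (X : 'M[Q]_(m, n)) (W : 'M[Q]_(r, p * m)) x i j :
  (W *m op2 p X) x (ix i j) = \sum_b W x (ix i b) * X b j.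
Proof.
rewrite mxE sum_tens exchange_big; apply: eq_bigr => b _.
rewrite (bigD1 i) //= tensmxE mxE eqxx mul1r big1 ?addr0 // => a.
by rewrite tensmxE mxE => /negPf ->; rewrite mul0r mulr0.
Qed.

Lemma op1_op2E (m n p r : nat) (X : 'M[Q]_(m, n)) (Y : 'M[Q]_(p, r)) i j k l :
  (op1 p X *m op2 n Y) (ix i j) (ix k l) = X i k * Y j l.
Proof.
rewrite mul_op1E (bigD1 k) //= tensmxE mxE eqxx mul1r big1 ?addr0 // => a.
by rewrite tensmxE mxE => /negPf ->; rewrite mul0r mulr0.
Qed.

Lemma op2_op1E (m n p r : nat) (X : 'M[Q]_(m, n)) (Y : 'M[Q]_(p, r)) i j k l :
  (op2 m Y *m op1 r X) (ix i j) (ix k l) = Y j l * X i k.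
Proof.
rewrite mul_op2E (bigD1 l) //= tensmxE mxE eqxx mulr1 big1 ?addr0 // => a.
by rewrite tensmxE mxE => /negPf ->; rewrite !mulr0.
Qed.

Lemma op1M (p m n r : nat) (X : 'M[Q]_(m, n)) (Y : 'M[Q]_(n, r)) :
  op1 p (X *m Y) = op1 p X *m op1 p Y.
Proof.
apply/tens_matrixP => i j k l; rewrite mul_op1E tensmxE mxE mulr_suml.
by apply: eq_bigr => a _; rewrite tensmxE mulrA.
Qed.

Lemma op2M (p m n r : nat) (X : 'M[Q]_(m, n)) (Y : 'M[Q]_(n, r)) :
  op2 p (X *m Y) = op2 p X *m op2 p Y.
Proof.
apply/tens_matrixP => i j k l; rewrite mul_op2E tensmxE [(X *m Y) _ _]mxE mulr_sumr.
apply: eq_bigr => b _; rewrite tensmxE mxE.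
by case: eqP; rewrite ?mul1r // !mul0r mulr0.
Qed.

Lemma op1_is_zmod_morphism (p m n : nat) :
  zmod_morphism (@op1 Q p m n).
Proof. by move=> X Y; apply/matrixP => x y; rewrite !mxE mulrBl. Qed.

Lemma op2_is_zmod_morphism (p m n : nat) :
  zmod_morphism (@op2 Q p m n).
Proof. by move=> X Y; apply/matrixP => x y; rewrite !mxE mulrBr. Qed.

HB.instance Definition _ (p m n : nat) :=
  GRing.isZmodMorphism.Build _ _ (@op1 Q p m n) (@op1_is_zmod_morphism p m n).
HB.instance Definition _ (p m n : nat) :=
  GRing.isZmodMorphism.Build _ _ (@op2 Q p m n) (@op2_is_zmod_morphism p m n).

(** The factors keep their order, unlike in an ordinary transposed product: each entry is a single
    product X_ik Y_jl in [Q], whose order transposition does not touch. *)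
Lemma tr_op1_op2 (m n p r : nat) (X : 'M[Q]_(m, n)) (Y : 'M[Q]_(p, r)) :
  (op1 p X *m op2 n Y)^T = op1 r X^T *m op2 m Y^T.
Proof.
by apply/tens_matrixP => i j k l; rewrite op1_op2E mxE op1_op2E !mxE.
Qed.

Lemma tr_op2_op1 (m n p r : nat) (X : 'M[Q]_(m, n)) (Y : 'M[Q]_(p, r)) :
  (op2 m Y *m op1 r X)^T = op2 n Y^T *m op1 p X^T.
Proof.
by apply/tens_matrixP => i j k l; rewrite op2_op1E mxE op2_op1E !mxE.
Qed.

Lemma mxswapM (m n p r s t : nat) (A : 'M[Q]_(m * n, p * r))
    (B : 'M[Q]_(p * r, s * t)) :
  mxswap (A *m B) = mxswap A *m mxswap B.
Proof.
apply/tens_matrixP => i j k l.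
rewrite mxswapE mxE sum_tens [RHS]mxE sum_tens exchange_big.
by apply: eq_bigr => b _; apply: eq_bigr => a _; rewrite !mxswapE.
Qed.

Lemma mxswap_op1 (p m n : nat) (X : 'M[Q]_(m, n)) : mxswap (op1 p X) = op2 p X.
Proof.
apply/tens_matrixP => i j k l; rewrite mxswapE !tensmxE !mxE.
by case: eqP; rewrite ?mul1r ?mulr1 // mul0r mulr0.
Qed.

Lemma mxswap_op2 (p m n : nat) (X : 'M[Q]_(m, n)) : mxswap (op2 p X) = op1 p X.
Proof.
apply/tens_matrixP => i j k l; rewrite mxswapE !tensmxE !mxE.
by case: eqP; rewrite ?mul1r ?mulr1 // mul0r mulr0.
Qed.

Lemma mxswapB (m n p r : nat) (A B : 'M[Q]_(m * n, p * r)) :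
  mxswap (A - B) = mxswap A - mxswap B.
Proof. by apply/matrixP => x y; rewrite !mxE. Qed.

Lemma ptr2B (m n p r : nat) (A B : 'M[Q]_(m * n, p * r)) :
  ptr2 (A - B) = ptr2 A - ptr2 B.
Proof. by apply/matrixP => x y; rewrite !mxE. Qed.

Lemma ptr2_op1l (m n p r s : nat) (X : 'M[Q]_(m, n)) (W : 'M[Q]_(n * p, r * s)) :
  ptr2 (op1 p X *m W) = op1 s X *m ptr2 W.
Proof.
apply/tens_matrixP => i j k l; rewrite ptr2E !mul_op1E.
by apply: eq_bigr => a _; rewrite ptr2E.
Qed.

Lemma ptr2_op1r (m n p r s : nat) (X : 'M[Q]_(m, n)) (W : 'M[Q]_(r * s, m * p)) :
  ptr2 (W *m op1 p X) = ptr2 W *m op1 s X.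
Proof.
apply/tens_matrixP => i j k l; rewrite ptr2E !mulmx_op1E.
by apply: eq_bigr => a _; rewrite ptr2E.
Qed.

End TensorOperators.

Section Scalars.
Variables (K : fieldType) (Q : algType K).
Local Notation sc := (scal_mx Q).

Lemma scal_mxM (m n p : nat) (A : 'M[K]_(m, n)) (B : 'M[K]_(n, p)) :
  sc (A *m B) = sc A *m sc B.
Proof. exact: (map_mxM (in_alg Q)). Qed.

Lemma scal_mxD (m n : nat) (A B : 'M[K]_(m, n)) : sc (A + B) = sc A + sc B.
Proof. exact: (map_mxD (in_alg Q)). Qed.

Lemma scal_mx1 (n : nat) : sc 1%:M = 1%:M :> 'M_n.
Proof. exact: (map_mx1 (in_alg Q)). Qed.

Lemma alg_comm (c : K) (x : Q) : c%:A * x = x * c%:A.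
Proof. by rewrite mulr_algl mulr_algr. Qed.

Lemma scal_scalar_mxC (m n : nat) (c : K) (W : 'M[Q]_(m, n)) :
  sc c%:M *m W = W *m sc c%:M.
Proof.
have scE k : sc (c%:M : 'M_k) = (c%:A)%:M by apply: (map_scalar_mx (in_alg Q)).
apply/matrixP => i j; rewrite !scE mul_scalar_mx [LHS]mxE alg_comm.
rewrite mxE (bigD1 j) //= mxE eqxx mulr1n big1 ?addr0 // => k.
by rewrite mxE => /negPf ->; rewrite mulr0n mulr0.
Qed.

Lemma tr_mul_scal (m n p : nat) (W : 'M[Q]_(m, n)) (A : 'M[K]_(n, p)) :
  (W *m sc A)^T = sc A^T *m W^T.
Proof.
by apply/matrixP => i j; rewrite !mxE; apply: eq_bigr => k _; rewrite !mxE alg_comm.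
Qed.

Lemma tr_scal_mul (m n p : nat) (A : 'M[K]_(m, n)) (W : 'M[Q]_(n, p)) :
  (sc A *m W)^T = W^T *m sc A^T.
Proof.
by apply/matrixP => i j; rewrite !mxE; apply: eq_bigr => k _; rewrite !mxE alg_comm.
Qed.

Lemma mxswap_scal (m n p r : nat) (A : 'M[K]_(m * n, p * r)) :
  mxswap (sc A) = sc (mxswap A).
Proof. by apply/matrixP => x y; rewrite !mxE. Qed.

(** The two matrices may trade places because the entries of the scalar one are central in [Q]. *)
Lemma ptr2_op2_scal (m n p r s : nat) (Y : 'M[Q]_(m, n)) (A : 'M[K]_(p * n, r * s)) :
  ptr2 (op2 p Y *m sc A) = sc (ptr2 A) *m op2 r Y^T.
Proof.
apply/tens_matrixP => i j k l; rewrite ptr2E mul_op2E mulmx_op2E.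
by apply: eq_bigr => b _; rewrite [sc A _ _]mxE [sc _ _ _]mxE ptr2E mxE alg_comm.
Qed.

Lemma ptr2_scal_op2 (m n p r s : nat) (Y : 'M[Q]_(m, n)) (A : 'M[K]_(r * s, p * m)) :
  ptr2 (sc A *m op2 p Y) = op2 r Y^T *m sc (ptr2 A).
Proof.
apply/tens_matrixP => i j k l; rewrite ptr2E mul_op2E mulmx_op2E.
by apply: eq_bigr => b _; rewrite [sc A _ _]mxE [sc _ _ _]mxE ptr2E mxE alg_comm.
Qed.

End Scalars.

(** * Dividing a bilateral series by a quadratic scalar *)

Section Recurrence.
Variables (V : zmodType) (f : V -> V) (f0 : f 0 = 0).

Let upward (z : int -> V) (i : int) :
  (forall i, f (z i) = z (i - 1) + z (i + 1)) ->
  z i = 0 -> z (i + 1) = 0 -> forall n : nat, z (i + n%:Z) = 0.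
Proof.
move=> rec zi zi1 n; suff [] : z (i + n%:Z) = 0 /\ z (i + n%:Z + 1) = 0 by [].
elim: n => [|n [IH0 IH1]]; first by rewrite addr0.
rewrite -addn1 PoszD addrA; split=> //.
by have := rec (i + n%:Z + 1); rewrite IH1 f0 addrK IH0 add0r => <-.
Qed.

(** Two consecutive terms determine a second-order recurrence in both directions; the downward one
    is the upward one for k ↦ z(-k). *)
Lemma recurrence_eq0 (z : int -> V) (i : int) :
  (forall i, f (z i) = z (i - 1) + z (i + 1)) ->
  z i = 0 -> z (i + 1) = 0 -> forall j, z j = 0.
Proof.
move=> rec zi zi1 j; have [ij|ji] := leP i j.
  by rewrite (_ : j = i + `|j - i|%N%:Z); [apply: upward | lia].
have rec' k : f (z (- k)) = z (- (k - 1)) + z (- (k + 1)).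
  by rewrite rec addrC; congr (z _ + z _); lia.
(* The reflected sequence starts at -i - 1, where it takes the values z(i+1) and then z(i). *)
rewrite (_ : j = - (- i - 1 + (`|j - i|%N.+1)%:Z)); last lia.
by apply: (upward rec'); rewrite ?subrK ?opprK // opprD !opprK.
Qed.

End Recurrence.

(* Multiplying the relation [rel], of the form [R(u,v) P = N R(u,v)], by the  *)
(* adjugate [v U - u V] of [R(u,v)] on both sides gives the claimed identity   *)
(* times the scalar [c uv - u^2 - v^2]; on each antidiagonal, dividing by this *)
(* scalar amounts to solving a linear recurrence with two zero initial terms.  *)
Lemma reverse_exchange (K : fieldType) (Q : algType K) (m n : nat) (c : K)
    (Xl Rl Ul Vl : 'M[K]_m) (Xr Rr Ur Vr : 'M[K]_n)
    (P N : int -> int -> 'M[Q]_(m, n)) (i : int) :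
  Ul *m Rl = 1%:M -> Vl *m Xl = 1%:M -> Ul *m Xl + Vl *m Rl = c%:M ->
  Rr *m Ur = 1%:M -> Xr *m Vr = 1%:M -> Xr *m Ur + Rr *m Vr = c%:M ->
  (forall a b, scal_mx Q Xl *m P (a - 1) b - scal_mx Q Rl *m P a (b - 1)
             = N (a - 1) b *m scal_mx Q Xr - N a (b - 1) *m scal_mx Q Rr) ->
  (forall a b, i - 1 <= a <= i + 1 -> P a b = 0 /\ N a b = 0) ->
  forall a b, P a (b - 1) *m scal_mx Q Ur - P (a - 1) b *m scal_mx Q Vr
            = scal_mx Q Ul *m N a (b - 1) - scal_mx Q Vl *m N (a - 1) b.
Proof.
move=> UR VX UXVR RU XV XURV rel PN0.
(* [W] is the claimed right-hand side and [Z] the defect of the claimed identity, both as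
   coefficients of u^a v^b. *)
pose W (a b : int) := scal_mx Q Ul *m N a (b - 1) - scal_mx Q Vl *m N (a - 1) b.
pose Z (a b : int) :=
  P a (b - 1) *m scal_mx Q Ur - P (a - 1) b *m scal_mx Q Vr - W a b.
(* Multiplication by the adjugate on the left: (c uv - u^2 - v^2) P = W R(u,v). *)
have left_rel (a b : int) : scal_mx Q c%:M *m P (a - 1) (b - 1) - P a (b - 1 - 1)
      - P (a - 1 - 1) b = W (a - 1) b *m scal_mx Q Xr - W a (b - 1) *m scal_mx Q Rr.
  transitivity (scal_mx Q Ul *m (scal_mx Q Xl *m P (a - 1) (b - 1)
                  - scal_mx Q Rl *m P a (b - 1 - 1))
              - scal_mx Q Vl *m (scal_mx Q Xl *m P (a - 1 - 1) b
                  - scal_mx Q Rl *m P (a - 1) (b - 1))).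
    rewrite -UXVR scal_mxD mulmxDl !mulmxBr !mulmxA -!scal_mxM UR VX scal_mx1.
    rewrite !mul1mx opprB; set A := _ *m _; set B := _ *m _.
    by rewrite [RHS]addrACA [A + B + _]addrAC addrA [A - _ + B]addrAC addrAC.
  rewrite !rel /W !mulmxBl !mulmxBr !mulmxA; set A := _ *m _; set B := _ *m _.
  set C := _ *m _; set D := _ *m _.
  by rewrite !opprB addrACA [RHS]addrACA [- B - C]addrC.
(* Multiplication by the adjugate on the right gives (c uv - u^2 - v^2) Z = 0, because the scalar
   commutes with W. *)
have Zrec (a b : int) :
    scal_mx Q c%:M *m Z a b = Z (a - 1) (b + 1) + Z (a + 1) (b - 1).
  have left_rel' (a' b' : int) : scal_mx Q c%:M *m P a' b' =
      P (a' + 1) (b' - 1) + P (a' - 1) (b' + 1)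
        + (W a' (b' + 1) *m scal_mx Q Xr - W (a' + 1) b' *m scal_mx Q Rr).
    have := left_rel (a' + 1) (b' + 1); rewrite !addrK => <-.
    by rewrite [RHS]addrC [X in _ = _ + X]addrC addrA !subrK.
  rewrite /Z; clearbody W; rewrite [a + 1 - 1]addrK [b + 1 - 1]addrK.
  rewrite 2!mulmxBr [_ *m W a b]scal_scalar_mxC !mulmxA !left_rel' !subrK.
  rewrite -XURV scal_mxD !scal_mxM mulmxDr !mulmxDl !mulNmx -!mulmxA -!scal_mxM.
  rewrite XV RU scal_mx1 !mulmx1 !opprD !opprK.
  (* Two triples form the neighbouring defects; the remaining four terms cancel in pairs. *)
  rewrite [LHS](AC ((2*2)*(2*2)*2) (((2*6*7)*(1*5*4))*(3*9)*(8*10)))%AC /=.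
  by rewrite !subrr !addr0.
move=> a b; apply/eqP; rewrite -subr_eq0; apply/eqP.
pose z (k : int) := Z k (a + b - k).
have -> : P a (b - 1) *m scal_mx Q Ur - P (a - 1) b *m scal_mx Q Vr -
   (scal_mx Q Ul *m N a (b - 1) - scal_mx Q Vl *m N (a - 1) b) = z a.
  by rewrite /z (_ : a + b - a = b) //; lia.
(* The defect at k involves the exponents k and k - 1 only, so three consecutive zeros of P and N
   yield two of Z. *)
have Z0 (k d : int) : i <= k <= i + 1 -> Z k d = 0.
  move=> ik; have [|P0 N0] := @PN0 k (d - 1); first lia.
  have [|P1 N1] := @PN0 (k - 1) d; first lia.
  by rewrite /Z /W P0 N0 P1 N1 !mul0mx !mulmx0 !subr0.
apply: (@recurrence_eq0 _ (mulmx (scal_mx Q c%:M)) (mulmx0 _ _) z i).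
- move=> k; rewrite /z Zrec; congr (Z _ _ + Z _ _); lia.
- by apply: Z0; lia.
- by apply: Z0; lia.
Qed.

(** * Formal series *)

Section Series.
Variable Q : pzRingType.

(** Coefficients are evaluated through a finite list carrying all nonzero terms, so the default
    value of a sum with infinite support never interferes. *)
Lemma fmul_seq (E : zmodType) (m n p : nat) (r : seq E)
    (F : fser E Q m n) (G : fser E Q n p) (e : E) :
  uniq r -> (forall d, d \notin r -> F d *m G (e - d) = 0) ->
  (F *f G) e = \sum_(d <- r) F d *m G (e - d).
Proof.
move=> r_uniq F0; rewrite /fmul (@fsbigE _ _ _ _ _ r) // => [|d _ /F0 //].
by apply: eq_bigl => d; rewrite in_setT.
Qed.

Lemma fmul_seqr (E : zmodType) (m n p : nat) (r : seq E)
    (F : fser E Q m n) (G : fser E Q n p) (e : E) :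
  uniq r -> (forall d, d \notin r -> F (e - d) *m G d = 0) ->
  (F *f G) e = \sum_(d <- r) F (e - d) *m G d.
Proof.
move=> r_uniq FG0; rewrite (@fmul_seq _ _ _ _ [seq e - d | d <- r]).
- by rewrite big_map; apply: eq_bigr => d _; rewrite subKr.
- by rewrite map_inj_uniq // => x y /addrI/oppr_inj.
move=> d dr; have := FG0 (e - d); rewrite subKr; apply.
by apply: contra dr => /(map_f (fun x => e - x)); rewrite subKr.
Qed.

Lemma binom_fmulE (E : zmodType) (m n p : nat) (e1 e2 : E) (A B : 'M[Q]_(m, n))
    (G : fser E Q n p) (e : E) :
  e1 != e2 -> (fser_sub (fmono e1 A) (fmono e2 B) *f G) e
              = A *m G (e - e1) - B *m G (e - e2).
Proof.
move=> e12; rewrite (@fmul_seq _ _ _ _ [:: e1; e2]) /=.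
- rewrite !big_cons big_nil addr0 /fser_sub /fmono !eqxx (negPf e12).
  by rewrite [e2 == e1]eq_sym (negPf e12) subr0 sub0r mulNmx.
- by rewrite inE e12.
move=> d; rewrite !inE negb_or /fser_sub /fmono => /andP[/negPf-> /negPf->].
by rewrite subr0 mul0mx.
Qed.

Lemma fmul_binomE (E : zmodType) (m n p : nat) (e1 e2 : E) (A B : 'M[Q]_(n, p))
    (F : fser E Q m n) (e : E) :
  e1 != e2 -> (F *f fser_sub (fmono e1 A) (fmono e2 B)) e
              = F (e - e1) *m A - F (e - e2) *m B.
Proof.
move=> e12; rewrite (@fmul_seqr _ _ _ _ [:: e1; e2]) /=.
- rewrite !big_cons big_nil addr0 /fser_sub /fmono !eqxx (negPf e12).
  by rewrite [e2 == e1]eq_sym (negPf e12) subr0 sub0r mulmxN.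
- by rewrite inE e12.
move=> d; rewrite !inE negb_or /fser_sub /fmono => /andP[/negPf-> /negPf->].
by rewrite subr0 mulmx0.
Qed.

Lemma fmul_fop1E (m n p r : nat) (F : fser (int * int) Q r (m * p))
    (X : fser int Q m n) (s : seq int) (a b : int) :
  uniq s -> (forall d, d \notin s -> F (d, b) *m op1 p (X (a - d)) = 0) ->
  (F *f fop1 p X) (a, b) = \sum_(d <- s) F (d, b) *m op1 p (X (a - d)).
Proof.
move=> s_uniq F0; rewrite (@fmul_seq _ _ _ _ [seq (d, b) | d <- s]).
- by rewrite big_map; apply: eq_bigr => d _; rewrite /fop1 /= subrr eqxx.
- by rewrite map_inj_uniq // => x y [].
move=> [d c]; rewrite /fop1 /= subr_eq0.
case: eqP => [<- db|_ _]; last by rewrite mulmx0.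
by apply: F0; apply: contra db => /(map_f (fun d => (d, b))).
Qed.

Lemma fmul_fop2E (m n p r : nat) (F : fser (int * int) Q r (p * m))
    (X : fser int Q m n) (s : seq int) (a b : int) :
  uniq s -> (forall d, d \notin s -> F (a, d) *m op2 p (X (b - d)) = 0) ->
  (F *f fop2 p X) (a, b) = \sum_(d <- s) F (a, d) *m op2 p (X (b - d)).
Proof.
move=> s_uniq F0; rewrite (@fmul_seq _ _ _ _ [seq (a, d) | d <- s]).
- by rewrite big_map; apply: eq_bigr => d _; rewrite /fop2 /= subrr eqxx.
- by rewrite map_inj_uniq // => x y [].
move=> [c d]; rewrite /fop2 /= subr_eq0.
case: eqP => [<- db|_ _]; last by rewrite mulmx0.
by apply: F0; apply: contra db => /(map_f (fun d => (a, d))).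
Qed.

Lemma fop2_fop1E (m n p r : nat) (X : fser int Q m n) (Y : fser int Q p r) a b :
  (fop2 m Y *f fop1 r X) (a, b) = op2 m (Y b) *m op1 r (X a).
Proof.
rewrite (@fmul_fop1E _ _ _ _ _ _ [:: 0]) //.
  by rewrite big_seq1 /fop2 eqxx subr0.
by move=> d; rewrite inE /fop2 /= => /negPf ->; rewrite mul0mx.
Qed.

(* The series that are multiplied associatively below are all bounded above   *)
(* in both exponents, unlike [Tminus] itself.                                 *)
Class bounded_above (m n : nat) (F : fser (int * int) Q m n) : Prop :=
  bounded_above_ex : exists N : nat,
    forall a b, (N%:Z < a) || (N%:Z < b) -> F (a, b) = 0.

Definition box (N : nat) : seq (int * int) :=
  [seq (a, b) | a <- [seq i%:Z - N%:Z | i <- iota 0 (N + N).+1],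
                b <- [seq i%:Z - N%:Z | i <- iota 0 (N + N).+1]].

Lemma box_uniq N : uniq (box N).
Proof.
have inj : injective (fun i : nat => i%:Z - N%:Z) by move=> x y /addIr[].
apply: allpairs_uniq; rewrite ?(map_inj_uniq inj) ?iota_uniq //.
by move=> [x y] [z t].
Qed.

Lemma mem_box N (a b : int) :
  ((a, b) \in box N) = (- N%:Z <= a <= N%:Z) && (- N%:Z <= b <= N%:Z).
Proof.
have mem (c : int) : (c \in [seq i%:Z - N%:Z | i <- iota 0 (N + N).+1])
    = (- N%:Z <= c <= N%:Z).
  apply/mapP/idP => [[j]|cN]; first by rewrite mem_iota; lia.
  by exists (absz (c + N%:Z)); rewrite ?mem_iota; lia.
rewrite -!mem; apply/allpairsP/andP => [[[x y] /= [xN yN [-> ->]]] //|[aN bN]].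
by exists (a, b).
Qed.

Lemma bounded_fmul0 (m n p : nat) (F : fser (int * int) Q m n)
    (G : fser (int * int) Q n p) (N M : nat) :
  (forall a b, (N%:Z < a) || (N%:Z < b) -> F (a, b) = 0) ->
  (forall a b, (M%:Z < a) || (M%:Z < b) -> G (a, b) = 0) ->
  forall e d, ((N + M)%:Z < e.1) || ((N + M)%:Z < e.2) -> F d *m G (e - d) = 0.
Proof.
move=> F0 G0 [a b] [c d] /= abNM.
have [cd|cd] := boolP ((N%:Z < c) || (N%:Z < d)); first by rewrite F0 ?mul0mx.
by rewrite (G0 (a - c) (b - d)) ?mulmx0 //; lia.
Qed.

#[export] Instance bounded_above_mul (m n p : nat) (F : fser (int * int) Q m n)
    (G : fser (int * int) Q n p) (bF : bounded_above F) (bG : bounded_above G) :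
  bounded_above (F *f G).
Proof.
case: bF bG => [N F0] [M G0]; exists (N + M)%N => a b abNM.
by apply: fsbig1 => d _; apply: bounded_fmul0 F0 G0 _ _ _.
Qed.

(** Both sides are the sum of F(c) G(d - c) H(e - d) over c and d; the upper bounds on the three
    series leave finitely many nonzero terms, so the summations may be exchanged. *)
Lemma fmulA (m n p r : nat) (F : fser (int * int) Q m n)
    (G : fser (int * int) Q n p) (H : fser (int * int) Q p r)
    (bF : bounded_above F) (bG : bounded_above G) (bH : bounded_above H) :
  F *f (G *f H) = F *f G *f H.
Proof.
case: bF bG bH => [NF F0] [NG G0] [NH H0].
apply/funext => -[a b].
pose M := (`|a| + `|b|)%N; pose N := (NF + NG + NH)%N.
have aM : - M%:Z <= a <= M%:Z by lia.
have bM : - M%:Z <= b <= M%:Z by lia.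
(* A nonzero term has c at most NF, d - c at most NG and e - d at most NH in each component, which
   bounds c and d by M + N in absolute value; both boxes cover this range. *)
pose r1 := box (M + N + N); pose r2 := box (M + N + N + N).
rewrite (@fmul_seq _ _ _ _ r2) ?box_uniq //; last first.
  move=> [c d]; rewrite mem_box => cd.
  have [cN|cN] := boolP ((NF%:Z < c) || (NF%:Z < d)).
    by rewrite (F0 c d) // mul0mx.
  rewrite [X in _ *m X]fsbig1 ?mulmx0 // => x _.
  by apply: bounded_fmul0 G0 H0 _ _ _ => /=; lia.
rewrite [RHS](@fmul_seq _ _ _ _ r1) ?box_uniq //; last first.
  move=> [c d]; rewrite mem_box => cd.
  have [cN|cN] := boolP ((NH%:Z < a - c) || (NH%:Z < b - d)).
    by rewrite (H0 (a - c) (b - d)) // mulmx0.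
  rewrite [X in X *m _]fsbig1 ?mul0mx // => x _.
  by apply: bounded_fmul0 F0 G0 _ _ _ => /=; lia.
transitivity (\sum_(c <- r2) \sum_(d <- r1) F c *m G (d - c) *m H ((a, b) - d)).
  apply: eq_bigr => -[c1 c2] _.
  have [cN|cN] := boolP ((NF%:Z < c1) || (NF%:Z < c2)).
    by rewrite F0 // mul0mx big1 // => d _; rewrite !mul0mx.
  rewrite (@fmul_seq _ _ _ _ [seq d - (c1, c2) | d <- r1]).
  - rewrite big_map mulmx_sumr; apply: eq_bigr => d _.
    by rewrite mulmxA; congr (_ *m H _); rewrite opprB addrA subrK.
  - by rewrite map_inj_uniq ?box_uniq // => x y /addIr.
  move=> [d1 d2] dr.
  have {}dr : (d1 + c1, d2 + c2) \notin r1.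
    apply: contra dr => /(map_f (fun d => d - (c1, c2))).
    by rewrite (_ : _ - _ = (d1, d2)) //; congr pair; rewrite /= addrK.
  move: dr; rewrite mem_box => dr.
  have [dN|dN] := boolP ((NG%:Z < d1) || (NG%:Z < d2)).
    by rewrite G0 ?mul0mx.
  by rewrite (H0 (a - c1 - d1) (b - c2 - d2)) ?mulmx0 //; lia.
rewrite exchange_big; apply: eq_big_seq => -[d1 d2]; rewrite mem_box => dr.
rewrite -mulmx_suml.
have [dN|dN] := boolP ((NH%:Z < a - d1) || (NH%:Z < b - d2)).
  by rewrite (H0 (a - d1) (b - d2)) // !mulmx0.
congr (_ *m _); rewrite (@fmul_seq _ _ _ _ r2) ?box_uniq // => -[c1 c2].
rewrite mem_box => cr.
have [cN|cN] := boolP ((NF%:Z < c1) || (NF%:Z < c2)); first by rewrite F0 ?mul0mx.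
by rewrite (G0 (d1 - c1) (d2 - c2)) ?mulmx0 //; lia.
Qed.

Class bounded_above1 (m n : nat) (X : fser int Q m n) : Prop :=
  bounded_above1_ex : exists N : nat, forall a, N%:Z < a -> X a = 0.

#[export] Instance bounded_above_fop1 (p m n : nat) (X : fser int Q m n)
  (bX : bounded_above1 X) : bounded_above (fop1 p X).
Proof.
case: bX => N X0; exists N => a b; rewrite /fop1 /= => abN.
by case: eqP => // b0; rewrite X0 ?raddf0 //; lia.
Qed.

#[export] Instance bounded_above_fop2 (p m n : nat) (X : fser int Q m n)
  (bX : bounded_above1 X) : bounded_above (fop2 p X).
Proof.
case: bX => N X0; exists N => a b; rewrite /fop2 /= => abN.
by case: eqP => // b0; rewrite X0 ?raddf0 //; lia.
Qed.

#[export] Instance bounded_above_binom (m n : nat)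
  (e1 e2 : int * int) (A B : 'M[Q]_(m, n)) :
  bounded_above (fser_sub (fmono e1 A) (fmono e2 B)).
Proof.
exists (`|e1.1| + `|e1.2| + `|e2.1| + `|e2.2|)%N => a b abN.
rewrite /fser_sub /fmono; case: eqP abN => [<-|_] /=; first lia.
by case: eqP => [<-|_] /=; [lia | rewrite subrr].
Qed.

Lemma bounded_fmul_seq (m n p : nat) (X : fser int Q m n) (Y : fser int Q n p)
    (bX : bounded_above1 X) (bY : bounded_above1 Y) (a : int) :
  exists s : seq int, uniq s /\ (forall d, d \notin s -> X d = 0 \/ Y (a - d) = 0).
Proof.
case: bX bY => [N X0] [M Y0].
exists [seq i%:Z + a - M%:Z | i <- iota 0 (absz (N%:Z + M%:Z - a)%R).+1]; split.
  by rewrite map_inj_uniq ?iota_uniq // => x y /addIr/addIr[].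
move=> d /mapP ds; have [Nd|dN] := ltP N%:Z d; first by left; apply: X0.
right; apply: Y0; rewrite ltNge; apply/negP => da; case: ds.
by exists (absz (d - a + M%:Z)); rewrite ?mem_iota; lia.
Qed.

Lemma fop1M (p m n r : nat) (X : fser int Q m n) (Y : fser int Q n r)
    (bX : bounded_above1 X) (bY : bounded_above1 Y) :
  fop1 p (X *f Y) = fop1 p X *f fop1 p Y.
Proof.
apply/funext => -[a b]; have [s [s_uniq s0]] := bounded_fmul_seq bX bY a.
rewrite (@fmul_fop1E _ _ _ _ _ _ s) //; last first.
  move=> d /s0; rewrite /fop1 /=; case: eqP => [_|]; last by rewrite mul0mx.
  by case=> ->; rewrite raddf0 ?mul0mx ?mulmx0.
rewrite {1}/fop1 /=; case: eqP => [->|/eqP/negPf b0]; last first.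
  by rewrite big1 // => d _; rewrite /fop1 b0 mul0mx.
rewrite (@fmul_seq _ _ _ _ s) //; last first.
  by move=> d /s0[] ->; rewrite ?mul0mx ?mulmx0.
by rewrite raddf_sum; apply: eq_bigr => d _ /=; rewrite op1M.
Qed.

Lemma fop2M (p m n r : nat) (X : fser int Q m n) (Y : fser int Q n r)
    (bX : bounded_above1 X) (bY : bounded_above1 Y) :
  fop2 p (X *f Y) = fop2 p X *f fop2 p Y.
Proof.
apply/funext => -[b a]; have [s [s_uniq s0]] := bounded_fmul_seq bX bY a.
rewrite (@fmul_fop2E _ _ _ _ _ _ s) //; last first.
  move=> d /s0; rewrite /fop2 /=; case: eqP => [_|]; last by rewrite mul0mx.
  by case=> ->; rewrite raddf0 ?mul0mx ?mulmx0.
rewrite {1}/fop2 /=; case: eqP => [->|/eqP/negPf b0]; last first.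
  by rewrite big1 // => d _; rewrite /fop2 b0 mul0mx.
rewrite (@fmul_seq _ _ _ _ s) //; last first.
  by move=> d /s0[] ->; rewrite ?mul0mx ?mulmx0.
by rewrite raddf_sum; apply: eq_bigr => d _ /=; rewrite op2M.
Qed.

End Series.

Arguments fmulA {Q m n p r} F G H {bF bG bH}.

(** * Exchange relations and the reflection equation *)

Section Exchange.
Variables (K : fieldType) (q : K) (q_neq0 : q != 0) (Q : algType K).
Local Notation sc := (scal_mx Q).

(** Computed directly so as to apply to T^-, which is unbounded above: only the exponents 0 and 1 of
    v occur to the left of Y(v). *)
Lemma Ruv_fop1_fop2E (k m p : nat) (X : fser int Q k m) (Y : fser int Q k p) a b :
  (Ruv q k Q *f fop1 k X *f fop2 m Y) (a, b) =
  sc (RmxNT q k) *m (op1 k (X (a - 1)) *m op2 m (Y b))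
  - sc (Rmx q k) *m (op1 k (X a) *m op2 m (Y (b - 1))).
Proof.
rewrite (@fmul_fop2E _ _ _ _ _ _ _ [:: 0; 1]) // => [|d].
  rewrite !big_cons big_nil addr0 !binom_fmulE // /fop1 /=.
  by rewrite !subr0 !mulmx0 subr0 sub0r ?addr0 mulNmx !mulmxA.
rewrite !inE negb_or => /andP[/negPf d0 /negPf d1].
by rewrite binom_fmulE // /fop1 /= subr0 d0 subr_eq0 d1 !mulmx0 subr0 mul0mx.
Qed.

Lemma fop2_fop1_RuvE (k m p : nat) (X : fser int Q m k) (Y : fser int Q p k) a b :
  (fop2 m Y *f fop1 k X *f Ruv q k Q) (a, b) =
  op2 m (Y b) *m op1 k (X (a - 1)) *m sc (RmxNT q k)
  - op2 m (Y (b - 1)) *m op1 k (X a) *m sc (Rmx q k).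
Proof. by rewrite fmul_binomE // !fop2_fop1E !subr0. Qed.

Lemma fop1_Rt1uv_fop2E (k m p : nat) (X : fser int Q m k) (Z : fser int Q k p) a b :
  (fop1 k X *f Rt1uv q k Q *f fop2 k Z) (a, b) =
  op1 k (X (a + 1)) *m sc (ptr1 (RmxNT q k)) *m op2 k (Z b)
  - op1 k (X a) *m sc (ptr1 (Rmx q k)) *m op2 k (Z (b - 1)).
Proof.
rewrite (@fmul_fop2E _ _ _ _ _ _ _ [:: 0; 1]) // => [|d].
  rewrite !big_cons big_nil addr0 !fmul_binomE // /fop1 /=.
  by rewrite !subr0 !mul0mx subr0 sub0r ?addr0 mulNmx.
rewrite !inE negb_or => /andP[/negPf d0 /negPf d1].
by rewrite fmul_binomE // /fop1 /= subr0 d0 subr_eq0 d1 !mul0mx subr0 mul0mx.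
Qed.

Lemma fop2_Rt1uv_fop1E (k m p : nat) (X : fser int Q m k) (Z : fser int Q k p) a b :
  (fop2 k X *f Rt1uv q k Q *f fop1 k Z) (a, b) =
  op2 k (X b) *m sc (ptr1 (RmxNT q k)) *m op1 k (Z (a + 1))
  - op2 k (X (b - 1)) *m sc (ptr1 (Rmx q k)) *m op1 k (Z a).
Proof.
rewrite (@fmul_fop1E _ _ _ _ _ _ _ [:: - 1; 0]) // => [|d].
  rewrite !big_cons big_nil addr0 !fmul_binomE // /fop2 /=.
  by rewrite !subr0 !mul0mx subr0 sub0r ?addr0 mulNmx opprK.
rewrite !inE negb_or => /andP[/negPf d0 /negPf d1].
by rewrite fmul_binomE // /fop2 /= !subr0 d1 subr_eq0 d0 !mul0mx subr0 mul0mx.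
Qed.

Lemma Ruv_Rt1uvC (k : nat) :
  Ruv q k Q *f Rt1uv q k Q = Rt1uv q k Q *f Ruv q k Q.
Proof.
apply/funext => e; rewrite binom_fmulE // fmul_binomE //.
by congr (_ - _); rewrite /Rt1uv /fser_sub /fmono mulmxBl mulmxBr;
  congr (_ - _); case: eqP => _; rewrite ?mul0mx ?mulmx0 // -!scal_mxM;
  [rewrite comm_RmxNT_ptr1_RmxNT | rewrite comm_RmxNT_ptr1_Rmx |
   rewrite comm_Rmx_ptr1_RmxNT | rewrite comm_Rmx_ptr1_Rmx].
Qed.

(** The exchange relation with R(u,v) traded for its adjugate v R^{-1} - u R^T, read off at u^a v^b.
    The gap of three zero coefficients in X is what permits the division. *)
Lemma RTT_reverse (n2 n1 : nat) (X Y : fser int Q n2 n1) (i : int) :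
  RTT_rel q X Y -> (forall a, i - 1 <= a <= i + 1 -> X a = 0) ->
  forall a b,
    op1 n2 (X a) *m op2 n1 (Y (b - 1)) *m sc (invmx (Rmx q n1))
    - op1 n2 (X (a - 1)) *m op2 n1 (Y b) *m sc (Rmx q n1)^T
    = sc (invmx (Rmx q n2)) *m (op2 n2 (Y (b - 1)) *m op1 n1 (X a))
    - sc (Rmx q n2)^T *m (op2 n2 (Y b) *m op1 n1 (X (a - 1))).
Proof.
move=> rel X0.
have Ru k := Rmx_unit k q_neq0.
apply: (@reverse_exchange K Q _ _ (hecke_const q) (RmxNT q n2) (Rmx q n2) _ _
  (RmxNT q n1) (Rmx q n1) _ _ (fun a b => op1 n2 (X a) *m op2 n1 (Y b))
  (fun a b => op2 n2 (Y b) *m op1 n1 (X a)) i).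
- exact: mulVmx.
- by rewrite -trmx_mul mulVmx // trmx1.
- exact: hecke_left.
- exact: mulmxV.
- by rewrite -trmx_mul mulmxV // trmx1.
- exact: hecke_right.
- by move=> a b; have := rel (a, b); rewrite Ruv_fop1_fop2E fop2_fop1_RuvE.
by move=> a b /X0 ->; rewrite !raddf0 mul0mx.
Qed.

Definition tr_inv (m n : nat) (Y : fser int Q m n) : fser int Q n m :=
  fser_tr (fser_inv Y).

Lemma exchange12 (n2 n1 : nat) (X Y : fser int Q n2 n1) (i : int) :
  RTT_rel q X Y -> (forall a, i - 1 <= a <= i + 1 -> X a = 0) ->
  fop1 n1 X *f Rt1uv q n1 Q *f fop2 n1 (tr_inv Y)
  = fop2 n2 (tr_inv Y) *f Rt1uv q n2 Q *f fop1 n2 X.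
Proof.
move=> rel X0; apply/funext => -[a b].
rewrite fop1_Rt1uv_fop2E fop2_Rt1uv_fop1E /tr_inv /fser_tr /fser_inv.
(* The indices reflect v ↦ v^{-1} and R^{t1}(u^{-1},v) = u^{-1} v (v^{-1} (R^{-T})^{t1} - u
   R^{t1}). *)
have := congr1 (@ptr2 _ _ _ _ _) (RTT_reverse rel X0 (a + 1) (1 - b)).
have -> : 1 - b - 1 = - b by lia.
have -> : - (b - 1) = 1 - b by lia.
rewrite addrK !ptr2B !mulmxA !ptr2_op1r -!mulmxA !ptr2_op1l !ptr2_op2_scal.
rewrite !ptr2_scal_op2 !mulmxA !ptr2_tr.
have ptr2_inv k : ptr2 (invmx (Rmx q k)) = ptr1 (RmxNT q k).
  by rewrite -ptr2_tr trmxK.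
by rewrite !ptr2_inv.
Qed.

(** This is [exchange12] with the tensor factors and the variables exchanged. The exponent shift
    comes from R^{t1}(v^{-1},u) = u v^{-1} R^{t1}(u^{-1},v). *)
Lemma exchange21 (n2 n1 : nat) (X Y : fser int Q n2 n1) (i : int) :
  RTT_rel q X Y -> (forall a, i - 1 <= a <= i + 1 -> X a = 0) ->
  fop2 n1 X *f Rt1uv q n1 Q *f fop1 n1 (tr_inv Y)
  = fop1 n2 (tr_inv Y) *f Rt1uv q n2 Q *f fop2 n2 X.
Proof.
move=> rel X0; apply/funext => -[a b].
have := congr1 (fun F => mxswap (F (b - 1, a + 1))) (exchange12 rel X0).
rewrite fop1_Rt1uv_fop2E fop2_Rt1uv_fop1E fop2_Rt1uv_fop1E fop1_Rt1uv_fop2E.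
rewrite subrK addrK !mxswapB !mxswapM !mxswap_op1 !mxswap_op2 !mxswap_scal.
by rewrite !mxswap_ptr1_Rmx ?mxswap_ptr1_RmxNT.
Qed.

(** Transposing the adjugate at (u^{-1}, v^{-1}) gives (uv)^{-1} R(u,v), so the total transpose of
    the reversed relation is again an exchange relation. *)
Lemma RTT_tr_inv (n2 n1 : nat) (Y : fser int Q n2 n1) (i : int) :
  RTT_rel q Y Y -> (forall a, i - 1 <= a <= i + 1 -> Y a = 0) ->
  Ruv q n1 Q *f fop1 n1 (tr_inv Y) *f fop2 n2 (tr_inv Y)
  = fop2 n1 (tr_inv Y) *f fop1 n2 (tr_inv Y) *f Ruv q n2 Q.
Proof.
move=> rel Y0; apply/funext => -[a b].
rewrite Ruv_fop1_fop2E fop2_fop1_RuvE /tr_inv /fser_tr /fser_inv.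
have := congr1 trmx (RTT_reverse rel Y0 (1 - a) (1 - b)).
have -> : 1 - b - 1 = - b by lia.
have -> : 1 - a - 1 = - a by lia.
have -> : - (b - 1) = 1 - b by lia.
have -> : - (a - 1) = 1 - a by lia.
by rewrite !raddfB /= !tr_mul_scal !tr_scal_mul !tr_op1_op2 !tr_op2_op1 !trmxK.
Qed.

#[export] Instance bounded_above_Ruv k : bounded_above (Ruv q k Q).
Proof. exact: bounded_above_binom. Qed.

#[export] Instance bounded_above_Rt1uv k : bounded_above (Rt1uv q k Q).
Proof. exact: bounded_above_binom. Qed.

(** The computation passes through V_{n2} ⊗ V_{n2}: moving X past the transposed Y carries R' there,
    R(u,v) follows and commutes with it, and the remaining two exchanges carry both back to V_{n1} ⊗
    V_{n1}. *)
Lemma affine_reflection_tr_inv_mul (n2 n1 : nat) (X Y : fser int Q n2 n1) (i j : int)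
    (bX : bounded_above1 X) (bY : bounded_above1 (tr_inv Y)) :
  RTT_rel q X X -> RTT_rel q X Y -> RTT_rel q Y Y ->
  (forall a, i - 1 <= a <= i + 1 -> X a = 0) ->
  (forall a, j - 1 <= a <= j + 1 -> Y a = 0) ->
  affine_reflection q (tr_inv Y *f X).
Proof.
move=> XX XY YY X0 Y0 e; congr (_ e).
have {}XX := funext XX.
have tRt := exchange12 XY X0; have t2Rt := exchange21 XY X0.
have zz := RTT_tr_inv YY Y0.
rewrite !fop1M !fop2M.
transitivity (Ruv q n1 Q *f fop1 n1 (tr_inv Y)
    *f (fop1 n1 X *f Rt1uv q n1 Q *f fop2 n1 (tr_inv Y)) *f fop2 n1 X).
  by rewrite !fmulA.
transitivity (Ruv q n1 Q *f fop1 n1 (tr_inv Y) *f fop2 n2 (tr_inv Y)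
    *f Rt1uv q n2 Q *f fop1 n2 X *f fop2 n1 X).
  by rewrite tRt !fmulA.
transitivity (fop2 n1 (tr_inv Y) *f fop1 n2 (tr_inv Y)
    *f (Ruv q n2 Q *f Rt1uv q n2 Q) *f fop1 n2 X *f fop2 n1 X).
  by rewrite zz !fmulA.
transitivity (fop2 n1 (tr_inv Y) *f fop1 n2 (tr_inv Y) *f Rt1uv q n2 Q
    *f (Ruv q n2 Q *f fop1 n2 X *f fop2 n1 X)).
  by rewrite Ruv_Rt1uvC !fmulA.
transitivity (fop2 n1 (tr_inv Y)
    *f (fop1 n2 (tr_inv Y) *f Rt1uv q n2 Q *f fop2 n2 X)
    *f fop1 n1 X *f Ruv q n1 Q).
  by rewrite XX !fmulA.
by rewrite -t2Rt !fmulA.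
Qed.

Lemma affine_reflection_lead (n : nat) (A : fser int Q n n) :
  (forall a, 0 <= a -> A a = 0) -> affine_reflection q A ->
  reflection q (A (- 1)).
Proof.
move=> A0 refl.
have bA : bounded_above1 A by exists 0%N => a /ltW/A0.
(* As A has only negative exponents, v^1 is the highest power of v, reached only through -vR,
   -vR^{t1} and the v^{-1} term of A(v); then u^{-1} selects the same coefficient of A(u). *)
have := refl (- 1, 1); rewrite -fmulA -fmulA (fmulA (fop1 n A)).
rewrite binom_fmulE // fmul_binomE //.
rewrite !fop1_Rt1uv_fop2E !fop2_Rt1uv_fop1E.
rewrite /= subrK (_ : 1 - 0 = 1 :> int) // (_ : - 1 - 0 = - 1 :> int) //.
rewrite (_ : - 1 + 1 = 0 :> int) // (_ : 1 - 1 - 1 = - 1 :> int) //.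
rewrite !(A0 0) // !(A0 1) // !raddf0 ?mul0mx !addr0 !sub0r ?mulmx0 ?mul0mx.
by rewrite !(sub0r, add0r, mul0mx, oppr0, mulmxN, mulNmx, opprK) !mulmxA.
Qed.

End Exchange.

Theorem theorem3p8 (R : realType) (q : R[i]) (q_neq0 : q != 0)
    (Q : algType R[i]) (n1 n2 : nat)
    (Tp Tm : nat -> 'M[Q]_(n2, n1))
    (T_loop : loop_realization q Tp Tm) :
  exists A : nat -> 'M[Q]_n1,
    [/\ AA Tp Tm =1 Aser A,
        A 0%N = (Tm 1%N)^T *m Tp 0%N,
        affine_reflection q (AA Tp Tm)
      & reflection q (A 0%N)].
Proof.
have [TT TS SS] := T_loop.
have AA0 a : 0 <= a -> AA Tp Tm a = 0.
  move=> a_ge0; apply: fsbig1 => d _; rewrite /fser_tr /fser_inv /Tminus /Tplus.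
  case: ifP => d0; last by rewrite trmx0 mul0mx.
  by rewrite ifF ?mulmx0 //; lia.
have refl : affine_reflection q (AA Tp Tm).
  (* T^+ vanishes at the exponents 1, 2, 3 and T^- at -2, -1, 0, hence the centres 2 and -1. *)
  apply: (@affine_reflection_tr_inv_mul _ _ q_neq0 _ _ _ _ _ 2 (- 1)) => //.
  - by exists 0%N => a a0; rewrite /Tplus ifF //; lia.
  - exists 0%N => a a0; rewrite /tr_inv /fser_tr /fser_inv /Tminus.
    by rewrite ifF ?trmx0 //; lia.
  - by move=> a a0; rewrite /Tplus ifF //; lia.
  - by move=> a a0; rewrite /Tminus ifF //; lia.
exists (fun k => AA Tp Tm (- k.+1%:Z)); split=> //.
- move=> a; rewrite /Aser; case: ltP => [a0|/AA0 //].
  by congr (AA Tp Tm _); lia.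
- rewrite /AA (@fmul_seq _ _ _ _ _ [:: - 1]) //.
    by rewrite big_seq1 subrr.
  move=> d; rewrite inE => d1; rewrite /fser_tr /fser_inv /Tminus /Tplus.
  case: ifP => d0; last by rewrite trmx0 mul0mx.
  by rewrite ifF ?mulmx0 //; lia.
- exact: affine_reflection_lead.
Qed.
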